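(* Let $S\subset\mathbb{R}^d$ be compact and let $\aleph_n=\{X_1,\dots,X_n\}\subset S$ be a sequence of finite sets such that $\gamma_n:=d_H(\aleph_n,S)\to 0$ as $n\to\infty$. Let $\varepsilon_n>0$ be a sequence with $\varepsilon_n\to 0$ and $\gamma_n^{1/2}=o(\varepsilon_n)$ as $n\to\infty$. Define $\tilde{\mathbf R}=\tilde{\mathbf R}_n=\inf\{t: G_n(t)>\varepsilon_n\}$. Then $\tilde{\mathbf R}\to\mathbf R$ as $n\to\infty$, where $\mathbf R\in[0,\infty]$ is the polynomial reach of $S$.
   Context: $S$ is non-empty. $d_H$ is the Hausdorff distance and $\mu$ is Lebesgue measure on $\mathbb{R}^d$. For $A\subset\mathbb{R}^d$ and $r\ge 0$, $B(A,r)=\{y\in\mathbb{R}^d:\inf_{x\in A}\|y-x\|\le r\}$. The volume function of $S$ is $V(r)=\mu(B(S,r))$, and the empirical volume function is $V_n(r)=\mu(B(\aleph_n,r))$, for $r\ge 0$. The polynomial reach of $S$ is $\mathbf R=\sup\{r\ge 0: V \text{ is a polynomial of degree at most } d \text{ on } [0,r]\}\in[0,\infty]$. For $t>0$, let $P_n^t$ be the best approximation of $V_n$ in $L^2([0,t])$ by polynomials of degree at most $d$ (i.e. the orthogonal projection onto the space of such polynomials), and set $G_n(t)=\|V_n-P_n^t\|_{L^2([0,t])}$, where $\|f\|_{L^2(I)}=(\int_I f^2)^{1/2}$. Convention: $\inf\emptyset=+\infty$, and convergence is understood in $[0,\infty]$. *)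

(* Defs.v *)
From HB Require Import structures.
From mathcomp Require Import all_boot all_order all_algebra.
From mathcomp Require Import all_classical all_reals all_analysis.
Set Implicit Arguments.
Unset Strict Implicit.
Unset Printing Implicit Defensive.
Import Order.TTheory GRing.Theory Num.Theory numFieldNormedType.Exports.
Local Open Scope classical_set_scope.
Local Open Scope ring_scope.

(** Points of R^d are row vectors.  The canonical norm of ['rV[R]_d] is the
    sup norm, so the Euclidean norm is defined separately; both induce the
    same (library) topology. *)
Definition enorm (R : realType) (d : nat) (x : 'rV[R]_d) : R :=
  Num.sqrt (\sum_(i < d) x 0 i ^+ 2).

(** Extended-real valued, so that the distance to the empty set is [+oo]. *)
Definition dist_to (R : realType) (d : nat) (A : set 'rV[R]_d)
    (y : 'rV[R]_d) : \bar R :=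
  ereal_inf [set (enorm (y - x))%:E | x in A].

Definition parallel_set (R : realType) (d : nat) (A : set 'rV[R]_d) (r : R) :
    set 'rV[R]_d :=
  [set y | (dist_to A y <= r%:E)%E].

Definition hausdorff_dist (R : realType) (d : nat) (A B : set 'rV[R]_d) :
    \bar R :=
  maxe (ereal_sup [set dist_to B x | x in A])
       (ereal_sup [set dist_to A y | y in B]).

(** A pair [c] encodes the open box with opposite corners [c.1] and [c.2]. *)
Definition open_box (R : realType) (d : nat) (c : 'rV[R]_d * 'rV[R]_d) :
    set 'rV[R]_d :=
  [set x | forall i, c.1 0 i < x 0 i < c.2 0 i].

Definition box_volume (R : realType) (d : nat) (c : 'rV[R]_d * 'rV[R]_d) : R :=
  \prod_(i < d) (c.2 0 i - c.1 0 i).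

Definition box_cover (R : realType) (d : nat) (A : set 'rV[R]_d) :
    set (set ('rV[R]_d * 'rV[R]_d)) :=
  [set C : set ('rV[R]_d * 'rV[R]_d) |
    [/\ countable C,
        forall c, C c -> forall i, c.1 0 i <= c.2 0 i
      & A `<=` \bigcup_(c in C) open_box c]].

(** The library has Lebesgue measure on [R] only.  On R^d it is obtained by
    Caratheodory's construction from the outer measure
    inf { sum of the volumes of C | C a countable cover by open boxes }. *)
Definition box_outer (R : realType) (d : nat) (A : set 'rV[R]_d) :
    \bar R :=
  ereal_inf [set (\esum_(c in C) (box_volume c)%:E)%E | C in box_cover A].

Section box_outer_theory.
Variables (R : realType) (d : nat).
Local Open Scope ereal_scope.
Implicit Types A B : set 'rV[R]_d.
Local Notation mu := (@box_outer R d).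

Let vol_ge0 A C : box_cover A C -> forall c, C c -> 0 <= (box_volume c)%:E.
Proof.
move=> [_ h _] c Cc; rewrite lee_fin; apply: prodr_ge0 => i _.
by rewrite subr_ge0; exact: h.
Qed.

Lemma box_outer_ge0 A : 0 <= mu A.
Proof.
apply: le_ereal_inf_tmp => _ [C hC <-]; apply: esum_ge0 => c Cc.
exact: vol_ge0 hC c Cc.
Qed.

Lemma box_outer0 : mu set0 = 0.
Proof.
apply/eqP; rewrite eq_le box_outer_ge0 andbT.
apply: ereal_inf_lbound; exists set0; last exact: esum_set0.
by split=> //; exact: countable0.
Qed.

Lemma le_box_outer : {homo mu : A B / A `<=` B >-> A <= B}.
Proof.
move=> A B AB; apply: ereal_inf_le_tmp => _ [C [cC hC BC] <-].
by exists C => //; split => //; exact: subset_trans BC.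
Qed.

Lemma box_outer_sigma_subadditive : sigma_subadditive mu.
Proof.
move=> A; have [[i ioo]|Aoo] := pselect (exists i, mu (A i) = +oo).
  rewrite (eseries_pinfty _ _ ioo) ?leey// => n _.
  by rewrite -ltNye (lt_le_trans _ (box_outer_ge0 _)).
apply/lee_addgt0Pr => e e0.
rewrite (le_trans _ (epsilon_trick _ _ (ltW e0)))//; last first.
  by move=> n; exact: box_outer_ge0.
have [C PC] : {C : nat -> set ('rV[R]_d * 'rV[R]_d) & forall n,
    box_cover (A n) (C n) /\
    \esum_(c in C n) (box_volume c)%:E
      <= mu (A n) + (e / (2 ^ n.+1)%:R)%:E}.
  apply: (@choice _ _ (fun n Cn => box_cover (A n) Cn /\ \esum_(c in Cn)
    (box_volume c)%:E <= mu (A n) + (e / (2 ^ n.+1)%:R)%:E)) => n.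
  have en : (0 < e / (2 ^ n.+1)%:R)%R by rewrite divr_gt0// ltr0n expn_gt0.
  have muA : mu (A n) \is a fin_num.
    rewrite ge0_fin_numE ?box_outer_ge0// ltey.
    by apply/eqP => Anoo; apply: Aoo; exists n.
  have [_ [Cn hC <-] /ltW le_C] := lb_ereal_inf_adherent en muA.
  by exists Cn.
pose a (c : 'rV[R]_d * 'rV[R]_d) := maxe 0 (box_volume c)%:E.
have aE n c : C n c -> (box_volume c)%:E = a c.
  by move=> Cc; rewrite /a max_r// (vol_ge0 (PC n).1 Cc).
have a0 c : 0 <= a c by rewrite le_max lexx.
apply: (@le_trans _ _ (\esum_(c in \bigcup_n C n) a c)).
  apply: ereal_inf_lbound; exists (\bigcup_n C n).
    split.
    - by apply: bigcup_countable => // n _; have [[]] := PC n.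
    - by move=> c [n _ Cc]; have [[_ + _] _] := PC n; apply.
    - move=> x [n _ Anx]; have [[_ _ /(_ x Anx) [c Cc cx]] _] := PC n.
      by exists c => //; exists n.
  by apply: eq_esum => c [n _]; exact: aE.
rewrite seqDU_bigcup_eq nneseries_sum_bigcup//.
apply: lee_nneseries => [n _ _|n _]; first exact: esum_ge0.
apply: le_trans (PC n).2.
rewrite [leRHS](_ : _ = \esum_(c in C n) a c); last first.
  by apply: eq_esum => c; exact: aE.
rewrite esum_mkcond [leRHS]esum_mkcond; apply: le_esum => c _.
case: ifPn => [/set_mem Cc|_]; first by rewrite (mem_set (subset_seqDU Cc)).
by case: ifPn.
Qed.

HB.instance Definition _ := isOuterMeasure.Build R 'rV[R]_d mu
  box_outer0 box_outer_ge0 le_box_outer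
  box_outer_sigma_subadditive.

End box_outer_theory.

Definition lebesgue_outer (R : realType) (d : nat) :
    {outer_measure set 'rV[R]_d -> \bar R} := @box_outer R d.

(** Its values are those of the outer measure.  It is only applied below to
    closed sets, which are Caratheodory measurable. *)
Definition lebesgue_rV (R : realType) (d : nat) :
    {measure set (caratheodory_type (lebesgue_outer R d)) -> \bar R} :=
  lebesgue_outer R d.

(** [fine] is harmless for bounded [A]: the measure is then finite. *)
Definition volume (R : realType) (d : nat) (A : set 'rV[R]_d) (r : R) : R :=
  fine (lebesgue_rV R d (parallel_set A r)).

Definition poly_reach (R : realType) (d : nat) (S : set 'rV[R]_d) : \bar R :=
  ereal_sup [set r%:E | r in [set r : R | 0 <= r /\
    exists p : {poly R}, (size p <= d.+1)%N /\
      forall s, 0 <= s <= r -> volume S s = p.[s]]].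

Definition L2norm (R : realType) (t : R) (f : R -> R) : R :=
  Num.sqrt (\int[lebesgue_measure]_(s in `[0, t]) (f s ^+ 2)).

Definition is_best_poly (R : realType) (d : nat) (t : R) (f : R -> R)
    (p : {poly R}) : Prop :=
  (size p <= d.+1)%N /\
  forall q : {poly R}, (size q <= d.+1)%N ->
    L2norm t (fun s => f s - p.[s]) <= L2norm t (fun s => f s - q.[s]).

(** The best approximation exists and is unique for [0 < t] and [f] square
    integrable on [[0, t]]; the default value [0] is then never used. *)
Definition best_poly (R : realType) (d : nat) (t : R) (f : R -> R) : {poly R} :=
  xget 0 [set p | is_best_poly d t f p].

Definition fit_error (R : realType) (d : nat) (A : set 'rV[R]_d) (t : R) : R :=
  L2norm t (fun s => volume A s - (best_poly d t (volume A)).[s]).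

Definition reach_estimator (R : realType) (d : nat) (A : set 'rV[R]_d)
    (eps : R) : \bar R :=
  ereal_inf [set t%:E | t in [set t : R | 0 < t /\ eps < fit_error A t]].

(* Main.v *)
Require Import Defs.
From mathcomp Require Import all_boot all_order all_algebra.
From mathcomp Require Import all_classical all_reals all_analysis.
From mathcomp Require Import measurable_realfun ring lra.
Import Order.TTheory GRing.Theory Num.Theory numFieldNormedType.Exports.
Set Implicit Arguments.
Unset Strict Implicit.
Unset Printing Implicit Defensive.
Local Open Scope classical_set_scope.
Local Open Scope ring_scope.

(** Let [V] and [W] be the volume functions of [S] and of the sample, and [g]
    their Hausdorff distance.  Then [V (s - g) <= W s <= V s], and since [V] is
    monotone the integral of [V s - V (s - g)] over [[0, t]] telescopes to at
    most [V t * g]; hence [||V - W||^2 <= V t ^ 2 * g] in L2 of [[0, t]].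
    Below the reach the fit error is thus [O(sqrt g) = o(eps)].  Beyond it, [V]
    has a positive L2 distance to the polynomials of degree at most [d]: a
    monotone function that agrees almost everywhere with a polynomial agrees
    with it everywhere in the interior, and at [0] because [V] is
    right-continuous there.  This distance passes to [W] up to [O(sqrt g)] and
    finally exceeds [eps]. *)

(** A quadratic in [t] that is never negative has a nonpositive discriminant. This serves both
    Cauchy-Schwarz inequalities, for the Euclidean norm and in L2. *)
Lemma discr_le (R : realFieldType) (a b c : R) : 0 <= b ->
  (forall t, 0 <= a + 2 * t * c + t ^+ 2 * b) -> c ^+ 2 <= a * b.
Proof.
move=> b0 abc; have [b_eq0|b_neq0] := eqVneq b 0.
  have [->|c0] := eqVneq c 0; first by rewrite b_eq0 mulr0 expr0n.
  (* For [b = 0] the expression is affine in [t]; this is where it takes the value -1. *)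
  have := abc (- (a + 1) / (2 * c)).
  suff -> : a + 2 * (- (a + 1) / (2 * c)) * c
            + (- (a + 1) / (2 * c)) ^+ 2 * b = -1 by lra.
  by rewrite b_eq0; field.
have bp : 0 < b by rewrite lt_def b_neq0.
(* The minimiser of the quadratic. *)
have := abc (- c / b).
have -> : a + 2 * (- c / b) * c + (- c / b) ^+ 2 * b = (a * b - c ^+ 2) / b.
  by field.
by rewrite pmulr_lge0 ?invr_gt0 // subr_ge0.
Qed.

(** * Euclidean norm, parallel sets and Hausdorff distance *)

Section geometry.
Variables (R : realType) (d : nat).
Implicit Types (x y z : 'rV[R]_d) (A B S : set 'rV[R]_d) (r s g : R).

Lemma enorm_ge0 x : 0 <= enorm x. Proof. exact: sqrtr_ge0. Qed.

Lemma enorm0 : enorm (0 : 'rV[R]_d) = 0.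
Proof. by rewrite /enorm big1 ?sqrtr0// => i _; rewrite mxE expr0n. Qed.

Lemma le_enorm_coord x i : `|x 0 i| <= enorm x.
Proof.
rewrite -(@ler_sqr _ `|x 0 i|) ?nnegrE ?enorm_ge0// real_normK ?num_real//.
rewrite sqr_sqrtr ?sumr_ge0// => [|j _]; last exact: sqr_ge0.
by rewrite (bigD1 i)//= lerDl sumr_ge0// => j _; exact: sqr_ge0.
Qed.

(** One expansion of the squared norm of [x + t *: y] is used twice: for all [t] it gives
    Cauchy-Schwarz, at [t = 1] the inequality itself. *)
Lemma ler_enormD x y : enorm (x + y) <= enorm x + enorm y.
Proof.
have sqge0 z : 0 <= \sum_(i < d) z 0 i ^+ 2.
  by apply: sumr_ge0 => i _; exact: sqr_ge0.
have expand t : \sum_(i < d) (x + t *: y) 0 i ^+ 2 =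
    \sum_(i < d) x 0 i ^+ 2 + 2 * t * (\sum_(i < d) x 0 i * y 0 i)
      + t ^+ 2 * \sum_(i < d) y 0 i ^+ 2.
  rewrite !mulr_sumr -!big_split /=; apply: eq_bigr => i _.
  by rewrite !mxE; ring.
have CS : \sum_(i < d) x 0 i * y 0 i <= enorm x * enorm y.
  rewrite (le_trans (ler_norm _))// -ler_sqr ?nnegrE ?mulr_ge0 ?enorm_ge0//.
  rewrite real_normK ?num_real// exprMn !sqr_sqrtr//.
  by apply: discr_le => // t; rewrite -expand.
rewrite -ler_sqr ?nnegrE ?addr_ge0 ?enorm_ge0//.
rewrite sqr_sqrtr// -[y in x + y]scale1r expand sqrrD.
by rewrite !sqr_sqrtr//; lra.
Qed.

(** The infimum need not be attained; the slack [e] replaces a nearest point. *)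
Lemma dist_to_leP A y r : (dist_to A y <= r%:E)%E <->
  forall e, 0 < e -> exists2 x, A x & enorm (y - x) < r + e.
Proof.
split=> [Ayr e e0|Ay].
  have : (dist_to A y < (r + e)%:E)%E.
    by rewrite (le_lt_trans Ayr)// lte_fin ltrDl.
  by move=> /ereal_inf_lt[_ [x Ax <-]]; rewrite lte_fin; exists x.
apply/lee_addgt0Pr => e /Ay[x Ax xy].
by apply: (@le_trans _ _ (enorm (y - x))%:E);
  [apply: ereal_inf_lbound; exists x | rewrite -EFinD lee_fin ltW].
Qed.

Lemma parallel_set_le A r s : r <= s -> parallel_set A r `<=` parallel_set A s.
Proof. by move=> rs y /le_trans; apply; rewrite lee_fin. Qed.

Lemma parallel_setS A B r : A `<=` B -> parallel_set A r `<=` parallel_set B r.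
Proof.
move=> AB y /dist_to_leP Ay; apply/dist_to_leP => e /Ay[x Ax xy].
by exists x => //; exact: AB.
Qed.

Lemma sub_parallel_set A r : 0 <= r -> A `<=` parallel_set A r.
Proof.
move=> r0 y Ay; apply/dist_to_leP => e e0; exists y => //.
by rewrite subrr enorm0 ltr_wpDl.
Qed.

(** Triangle inequality, with half of the slack spent on each leg. The radius [r] may be negative,
    as [s - g] is for small [s]. *)
Lemma parallel_set_trans A B r g : B `<=` parallel_set A g ->
  parallel_set B r `<=` parallel_set A (r + g).
Proof.
move=> BA y /dist_to_leP By; apply/dist_to_leP => e e0.
have [x Bx xy] := By _ (divr_gt0 e0 (ltr0n _ 2)).
have /dist_to_leP/(_ _ (divr_gt0 e0 (ltr0n _ 2)))[z Az zx] := BA x Bx.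
exists z => //; have -> : y - z = (y - x) + (x - z) by rewrite addrA subrK.
by rewrite (le_lt_trans (ler_enormD _ _))//; lra.
Qed.

Lemma hausdorff_sub_parallel A B g : (hausdorff_dist A B <= g%:E)%E ->
  B `<=` parallel_set A g.
Proof.
rewrite /hausdorff_dist ge_max => /andP[_ ABg] y By.
by apply: le_trans ABg; apply: ereal_sup_ubound; exists y.
Qed.

Lemma bounded_parallel_set A r : bounded_set A ->
  exists M, forall y, parallel_set A r y -> forall i, `|y 0 i| < M.
Proof.
move=> [M0 [_ hM]]; have {}hM := hM _ (ltr_pwDr ltr01 (lexx M0)).
exists (M0 + 1 + (r + 1)) => y /dist_to_leP/(_ _ ltr01)[x Ax xy] i.
have -> : y 0 i = x 0 i + (y - x) 0 i by rewrite !mxE; lra.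
rewrite (le_lt_trans (ler_normD _ _))// ler_ltD//; last first.
  exact: le_lt_trans (le_enorm_coord _ _) xy.
apply: le_trans (hM _ Ax); rewrite /Num.norm/= mx_normrE.
by apply: (le_bigmax _ (fun ij : 'I_1 * 'I_d => `|x ij.1 ij.2|) (0, i)).
Qed.

Lemma open_open_box (c : 'rV[R]_d * 'rV[R]_d) : open (open_box c).
Proof.
rewrite openE => x cx.
suff : nbhs x [set y : 'rV[R]_d | forall i, c.1 0 i < y 0 i < c.2 0 i] by [].
apply: (@filter_forall _ _ (fun i (y : 'rV[R]_d) => c.1 0 i < y 0 i < c.2 0 i)
  _ (nbhs_filter x)) => i.
apply: (@coord_continuous R 1 d 0 i x [set z | c.1 0 i < z < c.2 0 i]).
have /andP[c1x xc2] := cx i.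
near=> z; apply/andP; split; near: z; [exact: lt_nbhsr | exact: lt_nbhsl].
Unshelve. all: by end_near. Qed.

(** Each point of [A] has a neighbourhood on which one radius works; compactness, in its
    near-covering form, makes the radius uniform over [A]. *)
Lemma compact_parallel_open A U : compact A -> open U -> A `<=` U ->
  exists2 r, 0 < r & parallel_set A r `<=` U.
Proof.
move=> /compact_near_coveringP cA oU AU.
have : forall x : 'rV[R]_d, A x ->
    \forall x' \near x & e \near (0 : R)^'+,
    forall y, enorm (y - x') < e -> U y.
  move=> x Ax.
  have /nbhs_ballP[e /= e0 xU] : nbhs x U by apply: open_nbhs_nbhs;
    split => //; exact: AU.
  exists (ball x (e / 2), [set r | r < e / 2]) => /=.
    split; first by apply: nbhsx_ballx; rewrite divr_gt0.
    by apply: nbhs_right_lt; rewrite divr_gt0.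
  move=> [x' r] /= [xx' re] y yx'; apply: xU.
  rewrite [e]splitr; apply: (ball_triangle xx').
  apply: ball_sym; rewrite mx_norm_ball /ball_ /=.
  (* The library ball is that of the sup norm, which the Euclidean norm dominates. *)
  apply/(le_lt_trans _ (lt_trans yx' re)).
  rewrite /Num.norm/= mx_normrE; apply/bigmax_le; first exact: enorm_ge0.
  by move=> [i j] _ /=; rewrite (ord1 i) le_enorm_coord.
move=> /(cA R (0 : R)^'+ (fun e x => forall y, enorm (y - x) < e -> U y) _) AE.
have [r [AUr r0]] : exists r : R,
    (forall x, A x -> forall y, enorm (y - x) < r -> U y) /\ 0 < r.
  near (0 : R)^'+ => r; exists r; split => //.
  by near: r.
(* The other half of [r] pays for the slack in [dist_to_leP]. *)
exists (r / 2); first by rewrite divr_gt0.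
move=> y /dist_to_leP/(_ (r / 2))[|x Ax]; first by rewrite divr_gt0.
by rewrite -splitr; exact: AUr.
Unshelve. all: by end_near. Qed.

End geometry.

(** * Finiteness, monotonicity and right-continuity at 0 of the volume function *)

Section volume_function.
Variables (R : realType) (d : nat).
Implicit Types (A S : set 'rV[R]_d) (r s : R).
Local Notation mu := (@box_outer R d).

Lemma box_outer_bounded A M : (forall y, A y -> forall i, `|y 0 i| < M) ->
  mu A \is a fin_num.
Proof.
move=> AM; rewrite ge0_fin_numE ?box_outer_ge0//.
(* The cube with corners [- M] and [M] will cover [A]; a point of [A] ensures that its sides have
   nonnegative length. *)
have [->|/set0P[y0 Ay0]] := eqVneq A set0; first by rewrite box_outer0.
pose c : 'rV[R]_d * 'rV[R]_d := (const_mx (- M), const_mx M).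
apply: (@le_lt_trans _ _ (\esum_(c in [set c]) (box_volume c)%:E)%E).
  apply: ereal_inf_lbound; exists [set c] => //; split.
  - exact: countable1.
  - move=> _ -> i; rewrite !mxE.
    by have := AM _ Ay0 i; have := normr_ge0 (y0 0 i); lra.
  - by move=> y Ay; exists c => // i; rewrite !mxE -ltr_norml AM.
rewrite esum_set1 ?ltry// lee_fin; apply: prodr_ge0 => i _; rewrite !mxE.
by have := AM _ Ay0 i; have := normr_ge0 (y0 0 i); lra.
Qed.

Lemma volume_fin A r : bounded_set A -> mu (parallel_set A r) \is a fin_num.
Proof. by move=> /(bounded_parallel_set r)[M]; exact: box_outer_bounded. Qed.

Lemma volumeE A r : volume A r = fine (mu (parallel_set A r)).
Proof. by []. Qed.

Lemma volume_ge0 A r : 0 <= volume A r.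
Proof. by rewrite volumeE fine_ge0// box_outer_ge0. Qed.

Lemma le_volume A S r s : bounded_set A -> bounded_set S ->
  parallel_set A r `<=` parallel_set S s -> volume A r <= volume S s.
Proof.
by move=> bA bS AS; rewrite !volumeE fine_le ?volume_fin// le_box_outer.
Qed.

Lemma volume_nondecreasing A : bounded_set A ->
  {homo volume A : r s / r <= s}.
Proof. by move=> bA r s rs; apply: le_volume => //; exact: parallel_set_le. Qed.

(* The outer measure is outer regular by construction, which makes the
   measurability of [S] irrelevant. *)
Lemma volume_right_continuous0 S : compact S -> forall e, 0 < e ->
  exists2 r, 0 < r & volume S r <= volume S 0 + e.
Proof.
move=> cS e e0; have bS := compact_bounded cS.
have [_ [C [cC C0 SC] <-] Ce] := lb_ereal_inf_adherent e0 (volume_fin 0 bS).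
(* The union of a nearly optimal cover is open, so the same boxes still cover a parallel set of
   positive radius. *)
have [] := @compact_parallel_open _ _ S (\bigcup_(c in C) open_box c) cS.
- by apply: bigcup_open => c _; exact: open_open_box.
- by apply: subset_trans SC; exact: sub_parallel_set.
move=> r r0 rC; exists r => //.
rewrite -lee_fin EFinD !volumeE !fineK ?volume_fin//.
by apply: le_trans (ltW Ce); apply: ereal_inf_lbound; exists C.
Qed.
End volume_function.

(** * The L2 inner product on [[0, t]] and best polynomial approximation *)

Section square_norm.
Variables (R : realType) (t : R).
Implicit Types (f g h : R -> R) (p q : {poly R}).
Local Notation mu := (@lebesgue_measure R).

(** A class that contains polynomials and monotone functions, is stable under sums and products, and
    consists of integrable functions; it discharges all integrability conditions below. *)
Definition bounded_measurable f :=
  measurable_fun `[0, t]%classic f /\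
  exists M, forall s, 0 <= s <= t -> `|f s| <= M.

Lemma bounded_measurableD f g : bounded_measurable f -> bounded_measurable g ->
  bounded_measurable (fun s => f s + g s).
Proof.
move=> [mf [M fM]] [mg [N gN]]; split; first exact: measurable_funD.
exists (M + N) => s s0t.
by rewrite (le_trans (ler_normD _ _))// lerD ?fM ?gN.
Qed.

Lemma bounded_measurableM f g : bounded_measurable f -> bounded_measurable g ->
  bounded_measurable (fun s => f s * g s).
Proof.
move=> [mf [M fM]] [mg [N gN]]; split; first exact: measurable_funM.
by exists (M * N) => s s0t; rewrite normrM ler_pM ?fM ?gN.
Qed.

Lemma bounded_measurable_cst c : bounded_measurable (fun=> c).
Proof. by split; [exact: measurable_cst | exists `|c|]. Qed.

Lemma bounded_measurableB f g : bounded_measurable f -> bounded_measurable g ->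
  bounded_measurable (fun s => f s - g s).
Proof.
move=> bf bg; have -> : (fun s => f s - g s) = (fun s => f s + -1 * g s).
  by apply/funext => s; rewrite mulN1r.
by apply: bounded_measurableD => //; apply: bounded_measurableM => //;
  exact: bounded_measurable_cst.
Qed.

Lemma bounded_measurable_sqr f : bounded_measurable f ->
  bounded_measurable (fun s => f s ^+ 2).
Proof. by move=> bf; exact: bounded_measurableM. Qed.

Lemma bounded_measurable_horner p : bounded_measurable (fun s => p.[s]).
Proof.
elim/poly_ind: p => [|p c bp].
  have -> : (fun s => (0 : {poly R}).[s]) = fun=> 0.
    by apply/funext => s; rewrite horner0.
  exact: bounded_measurable_cst.
have -> : (fun s => (p * 'X + c%:P).[s]) = (fun s => p.[s] * s + c).
  by apply/funext => s; rewrite !hornerE.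
apply: bounded_measurableD; last exact: bounded_measurable_cst.
apply: bounded_measurableM => //; split; first exact: measurable_id.
by exists t => s /andP[s0 st]; rewrite ger0_norm.
Qed.

Lemma bounded_measurable_nondecreasing f : {homo f : r s / r <= s} ->
  bounded_measurable f.
Proof.
move=> ndf; split; first exact: nondecreasing_measurable.
exists (`|f 0| + `|f t|) => s /andP[/ndf f0s /ndf fst].
have := ler_norm (f t); have := ler_norm (- f 0); rewrite normrN => *.
by rewrite ler_norml; have := normr_ge0 (f t); have := normr_ge0 (f 0); lra.
Qed.

Lemma bounded_measurable_integrable f : bounded_measurable f ->
  mu.-integrable `[0, t] (EFin \o f).
Proof.
move=> [mf [M fM]]; apply: measurable_bounded_integrable => //.
  rewrite /= lebesgue_measure_itv/=; case: ifP => _; last exact: ltry.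
  by rewrite -EFinD ltry.
exists M; split; first exact: num_real.
move=> N MN s /=; rewrite in_itv/= => s0t.
exact: le_trans (fM _ s0t) (ltW MN).
Qed.

Definition inner f g := \int[mu]_(s in `[0, t]) (f s * g s).
Definition sqnorm f := \int[mu]_(s in `[0, t]) (f s ^+ 2).

Lemma innerDl f g h :
  bounded_measurable f -> bounded_measurable g -> bounded_measurable h ->
  inner (fun s => f s + g s) h = inner f h + inner g h.
Proof.
move=> bf bg bh; rewrite /inner -RintegralD//.
- by apply: eq_Rintegral => s _; rewrite mulrDl.
- by apply: bounded_measurable_integrable; exact: bounded_measurableM.
- by apply: bounded_measurable_integrable; exact: bounded_measurableM.
Qed.

Lemma innerZl c f h : bounded_measurable f -> bounded_measurable h ->
  inner (fun s => c * f s) h = c * inner f h.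
Proof.
move=> bf bh; rewrite /inner -RintegralZl//.
- by apply: eq_Rintegral => s _; rewrite mulrA.
- by apply: bounded_measurable_integrable; exact: bounded_measurableM.
Qed.

Lemma innerC f g : inner f g = inner g f.
Proof. by apply: eq_Rintegral => s _; rewrite mulrC. Qed.

Lemma innerBl f g h :
  bounded_measurable f -> bounded_measurable g -> bounded_measurable h ->
  inner (fun s => f s - g s) h = inner f h - inner g h.
Proof.
move=> bf bg bh; rewrite /inner -RintegralB//.
- by apply: eq_Rintegral => s _; rewrite mulrBl.
- by apply: bounded_measurable_integrable; exact: bounded_measurableM.
- by apply: bounded_measurable_integrable; exact: bounded_measurableM.
Qed.

Lemma sqnorm_ge0 f : 0 <= sqnorm f.
Proof. by apply: Rintegral_ge0 => s _; exact: sqr_ge0. Qed.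

Lemma sqnormE f : sqnorm f = inner f f. Proof. by []. Qed.

Lemma sqnormD f g : bounded_measurable f -> bounded_measurable g ->
  sqnorm (fun s => f s + g s) = sqnorm f + 2 * inner f g + sqnorm g.
Proof.
move=> bf bg; rewrite sqnormE innerDl//; last exact: bounded_measurableD.
by rewrite ![inner _ (fun s => _ + _)]innerC !innerDl// (innerC g f) !sqnormE;
  ring.
Qed.

Lemma sqnormZ c f : bounded_measurable f ->
  sqnorm (fun s => c * f s) = c ^+ 2 * sqnorm f.
Proof.
move=> bf; rewrite -RintegralZl//;
  last by apply: bounded_measurable_integrable; exact: bounded_measurable_sqr.
by apply: eq_Rintegral => s _; rewrite exprMn.
Qed.

(** A triangle inequality without square roots: the squared norm of [f - g] is nonnegative, which
    bounds the cross term. *)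
Lemma sqnormD_le f g : bounded_measurable f -> bounded_measurable g ->
  sqnorm (fun s => f s + g s) <= 2 * sqnorm f + 2 * sqnorm g.
Proof.
move=> bf bg; have bNg : bounded_measurable (fun s => -1 * g s).
  by apply: bounded_measurableM => //; exact: bounded_measurable_cst.
have := sqnorm_ge0 (fun s => f s + -1 * g s).
rewrite !sqnormD// sqnormZ// (innerC f (fun s => _ * _)) innerZl// (innerC g f).
by rewrite sqrrN expr1n; lra.
Qed.

(** Cauchy-Schwarz, from the squared norm of [f + a * g] as a quadratic in [a]. *)
Lemma inner_sqr_le f g : bounded_measurable f -> bounded_measurable g ->
  inner f g ^+ 2 <= sqnorm f * sqnorm g.
Proof.
move=> bf bg; apply: discr_le => [|a]; first exact: sqnorm_ge0.
have bag : bounded_measurable (fun s => a * g s) by apply: bounded_measurableM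
  => //; exact: bounded_measurable_cst.
suff <- : sqnorm (fun s => f s + a * g s) =
    sqnorm f + 2 * a * inner f g + a ^+ 2 * sqnorm g by exact: sqnorm_ge0.
rewrite sqnormD// sqnormZ//.
by rewrite (innerC f) innerZl// (innerC g f); ring.
Qed.

(** Gram-Schmidt. The induction is over all [f] at once, since its hypothesis is applied both to [f]
    and to ['X^k], whose residue [h] is the new orthogonal direction. *)
Lemma poly_projection k f : bounded_measurable f -> exists p,
  (size p <= k)%N /\ forall q, (size q <= k)%N ->
    inner (fun s => f s - p.[s]) (fun s => q.[s]) = 0.
Proof.
elim: k f => [|k IHk] f bf.
  exists 0; split=> [|q]; first by rewrite size_poly0.
  rewrite leqn0 size_poly_eq0 => /eqP ->; rewrite /inner.
  under eq_Rintegral do rewrite !horner0 mulr0.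
  by rewrite Rintegral_cst// mul0r.
have [e [ek eorth]] := IHk _ (bounded_measurable_horner 'X^k).
have [p [pk porth]] := IHk _ bf.
pose h := 'X^k - e; pose hs s := h.[s].
have bh : bounded_measurable hs by exact: bounded_measurable_horner.
have horth q : (size q <= k)%N -> inner hs (fun s => q.[s]) = 0.
  move=> /eorth <-; apply: eq_Rintegral => s _.
  by rewrite /hs /h hornerD hornerN.
have hk : (size h <= k.+1)%N.
  rewrite (leq_trans (size_polyD _ _))// size_polyXn size_polyN geq_max leqnn/=.
  exact: leqW.
have hlead : h`_k = 1 by rewrite coefB coefXn eqxx (nth_default _ ek) subr0.
(* If [h] has norm zero then [a] is the junk value [x / 0 = 0], which is fine:
   [h] is then orthogonal to everything. *)
pose a := inner f hs / sqnorm hs.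
have aE : a * sqnorm hs = inner f hs.
  have [h0|h0] := eqVneq (sqnorm hs) 0; last by rewrite divfK.
  rewrite h0 mulr0; apply/esym/eqP; rewrite -sqrf_eq0 eq_le sqr_ge0 andbT.
  by rewrite (le_trans (inner_sqr_le bf bh))// h0 mulr0.
have bah : bounded_measurable (fun s => a * hs s).
  by apply: bounded_measurableM => //; exact: bounded_measurable_cst.
have split_inner g : bounded_measurable g ->
    inner (fun s => f s - (p + a *: h).[s]) g =
    inner (fun s => f s - p.[s]) g - a * inner hs g.
  move=> bg; rewrite -innerZl// -innerBl//; last first.
    by apply: bounded_measurableB => //; exact: bounded_measurable_horner.
  by apply: eq_Rintegral => s _; rewrite hornerD hornerZ /hs; ring.
exists (p + a *: h); split.
  rewrite (leq_trans (size_polyD _ _))// geq_max (leqW pk)/=.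
  exact: leq_trans (size_scale_leq _ _) hk.
(* Since [h] has coefficient 1 at degree [k], this removes the top term of [q]; orthogonality is
   then checked on [q'] and on [h] separately. *)
move=> q qk; pose q' := q - q`_k *: h.
have q'k : (size q' <= k)%N.
  apply/leq_sizeP => j; rewrite leq_eqVlt coefB coefZ => /predU1P[<-|kj].
    by rewrite hlead mulr1 subrr.
  rewrite (nth_default 0 (leq_trans qk kj)) (nth_default 0 (leq_trans hk kj)).
  by rewrite mulr0 subr0.
have -> : (fun s => q.[s]) = (fun s => q'.[s] + q`_k * hs s).
  by apply/funext => s; rewrite /q' hornerD hornerN hornerZ /hs; ring.
have bp := bounded_measurable_horner.
have bfp : bounded_measurable (fun s => f s - (p + a *: h).[s]) by exact:
  bounded_measurableB.
rewrite innerC innerDl//; last by apply: bounded_measurableM => //;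
  exact: bounded_measurable_cst.
rewrite innerZl// !(innerC _ (fun s => f s - _)) !split_inner//.
rewrite porth// horth// innerBl// -sqnormE aE.
by rewrite (innerC (fun s => p.[s])) horth//; ring.
Qed.

Lemma L2normE f : L2norm t f = Num.sqrt (sqnorm f). Proof. by []. Qed.

Lemma sqr_L2norm f : L2norm t f ^+ 2 = sqnorm f.
Proof. by rewrite L2normE sqr_sqrtr// sqnorm_ge0. Qed.

(** By Pythagoras the orthogonal projection is a minimiser, so the choice in [best_poly] does not
    fall back on its default value. *)
Lemma best_poly_spec d f : bounded_measurable f ->
  is_best_poly d t f (best_poly d t f).
Proof.
move=> bf; apply: (xgetPex 0); have [p [pd orth]] := poly_projection d.+1 bf.
exists p; split => // q qd; rewrite !L2normE ler_wsqrtr//.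
have -> : sqnorm (fun s => f s - q.[s]) =
    sqnorm (fun s => f s - p.[s]) + sqnorm (fun s => (p - q).[s]).
  have -> : (fun s => f s - q.[s]) = (fun s => f s - p.[s] + (p - q).[s]).
    by apply/funext => s; rewrite hornerD hornerN; ring.
  rewrite sqnormD; [|by apply: bounded_measurableB => //;
    exact: bounded_measurable_horner|exact: bounded_measurable_horner].
  rewrite orth ?mulr0 ?addr0// (leq_trans (size_polyD _ _))//.
  by rewrite size_polyN geq_max pd.
by rewrite lerDl sqnorm_ge0.
Qed.
End square_norm.

(** * Shifts of monotone functions, and monotone functions that agree almost everywhere with a
    polynomial *)

Section monotone_functions.
Variable R : realType.
Implicit Types (V W : R -> R) (t g : R).
Local Notation mu := (@lebesgue_measure R).

(** The pushforward gives each interval []a, b]] its length, and these values determine Lebesgue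
    measure. *)
Lemma lebesgue_measure_shift g (A : set R) : measurable A ->
  pushforward mu (fun s : measurableTypeR R => s - g : measurableTypeR R) A
    = mu A.
Proof.
move=> mA; apply/esym/lebesgue_measure_unique => //=.
  by apply: measurable_funB => //; exact: measurable_cst.
move=> mphi _ [[a b]] _ <-.
rewrite /pushforward.
have -> : (fun s : measurableTypeR R => s - g) @^-1` `]a, b] = `]a + g, b +
  g]%classic.
  apply/seteqP; split=> x /=; rewrite !in_itv/=.
    by rewrite ltrBrDr lerBlDr.
  by rewrite ltrBrDr lerBlDr.
rewrite !lebesgue_measure_itv/= !lte_fin ltrD2r.
by rewrite -!EFinB; have -> : b + g - (a + g) = b - a by ring.
Qed.

Lemma integral_shift V t g : {homo V : r s / r <= s} -> (forall s, 0 <= V s) ->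
  (\int[mu]_(s in `[(- g)%R, (t - g)%R]) (V s)%:E =
   \int[mu]_(s in `[0%R, t]) (V (s - g)%R)%:E)%E.
Proof.
move=> ndV V0.
pose phi : measurableTypeR R -> measurableTypeR R := fun s => s - g.
have mphi : measurable_fun setT phi.
  by apply: measurable_funB => //; exact: measurable_cst.
have -> : `[0, t]%classic = phi @^-1` `[- g, t - g].
  by apply/seteqP; split=> s /=; rewrite /phi !in_itv/= lerBrDr addNr lerD2r.
rewrite -(@ge0_integral_pushforward _ _ _ (measurableTypeR R) R _ mphi mu
  _ (EFin \o V)) //=.
- apply: eq_measure_integral => //= A mA _.
  exact/esym/lebesgue_measure_shift.
- by apply/measurable_EFinP; exact: nondecreasing_measurable.
- by move=> s _; rewrite lee_fin.
Qed.

(** After the shift, the subtracted integral runs over [[- g, t - g]]. Together with []t - g, t]]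
    this covers [[0, t]], and on the latter interval, of length [g], [V] is at most [V t]. *)
Lemma Rintegral_increment_le V t g : {homo V : r s / r <= s} ->
  (forall s, 0 <= V s) -> 0 <= g -> 0 <= t ->
  \int[mu]_(s in `[0, t]) (V s - V (s - g)) <= V t * g.
Proof.
move=> ndV V0 g0 t0.
have bV : bounded_measurable t V by exact: bounded_measurable_nondecreasing.
have bVg : bounded_measurable t (fun s => V (s - g)).
  by apply: bounded_measurable_nondecreasing => r s rs; apply: ndV;
    rewrite lerD2r.
have mV D : measurable D -> measurable_fun D (EFin \o V).
  by move=> mD; apply/measurable_EFinP; exact: nondecreasing_measurable.
rewrite RintegralB//; [|exact: bounded_measurable_integrable..].
rewrite lerBlDl -lee_fin EFinD /Rintegral !fineK; last 2 first.
- exact: integrable_fin_num (bounded_measurable_integrable bVg).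
- exact: integrable_fin_num (bounded_measurable_integrable bV).
rewrite -integral_shift//.
have -> : (V t * g)%:E = (\int[mu]_(s in `](t - g)%R, t]) (V t)%:E)%E.
  rewrite integral_cst//= lebesgue_measure_itv/= lte_fin ltrBlDr ltrDl.
  case: ltP => [_|gle0]; first by rewrite -EFinB subKr.
  by have -> : g = 0 by [lra]; rewrite mulr0 mule0.
have dis : [disjoint `[- g, t - g]%classic & `]t - g, t]%classic].
  apply/disj_setPS => s [] /=; rewrite !in_itv/= => /andP[_ stg] /andP[tgs _].
  by lra.
apply: (@le_trans _ _
    (\int[mu]_(s in `[(- g)%R, (t - g)%R] `|` `](t - g)%R, t]) (V s)%:E)%E).
  apply: ge0_subset_integral => //.
  - exact: measurableU.
  - by apply: mV; exact: measurableU.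
  - by move=> s _; rewrite lee_fin.
  - move=> s /=; rewrite !in_itv/= => /andP[s0 st].
    by case: (leP s (t - g)) => stg; [left | right]; rewrite ?st// andbT; lra.
rewrite ge0_integral_setU//.
- apply: leeD2l; apply: ge0_le_integral => //=.
  + by move=> s _; rewrite lee_fin.
  + exact: mV.
  + by move=> s; rewrite in_itv/= lee_fin => /andP[_]; exact: ndV.
- by apply: mV; exact: measurableU.
- by move=> s _; rewrite lee_fin.
Qed.

(** In the square of [V s - W s], one factor is bounded by [V t] and the other by the increment
    [V s - V (s - g)], whose integral is at most [V t * g]. *)
Lemma sqnorm_sandwich_le V W t g : {homo V : r s / r <= s} ->
  {homo W : r s / r <= s} -> (forall s, 0 <= W s) -> (forall s, 0 <= V s) ->
  (forall s, W s <= V s) -> (forall s, V (s - g) <= W s) -> 0 <= g -> 0 <= t ->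
  sqnorm t (fun s => V s - W s) <= V t ^+ 2 * g.
Proof.
move=> ndV ndW W0 V0 WV VW g0 t0.
have bV : bounded_measurable t V by exact: bounded_measurable_nondecreasing.
have bW : bounded_measurable t W by exact: bounded_measurable_nondecreasing.
have bVg : bounded_measurable t (fun s => V (s - g)).
  by apply: bounded_measurable_nondecreasing => r s rs; apply: ndV;
    rewrite lerD2r.
have bD := bounded_measurableB bV bVg.
rewrite expr2 -mulrA; apply: le_trans (ler_wpM2l (V0 t) (Rintegral_increment_le
  ndV V0 g0 t0)).
rewrite -RintegralZl//; last exact: bounded_measurable_integrable.
apply: le_Rintegral => //.
- exact: bounded_measurable_integrable (bounded_measurable_sqr
  (bounded_measurableB bV bW)).
- exact: bounded_measurable_integrable (bounded_measurableM
  (bounded_measurable_cst t (V t)) bD).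
move=> s; rewrite /= in_itv/= => /andP[_ /ndV Vst].
rewrite expr2; apply: ler_pM.
- by rewrite subr_ge0.
- by rewrite subr_ge0.
- by have := W0 s; lra.
- by have := VW s; lra.
Qed.

(** Such an [f] vanishes outside a null set, and a null set contains no interval of positive
    length. *)
Lemma sqnorm0_dense f t a b : bounded_measurable t f -> sqnorm t f = 0 ->
  0 <= a -> a < b -> b <= t -> exists2 s, a < s < b & f s = 0.
Proof.
move=> bf f0 a0 ab bt.
have : (\int[mu]_(s in `[0%R, t]) `|(f s ^+ 2)%:E| = 0)%E.
  have -> : (\int[mu]_(s in `[0%R, t]) `|(f s ^+ 2)%:E| = (sqnorm t f)%:E)%E.
    rewrite /sqnorm /Rintegral fineK; last first.
      exact: integrable_fin_num (bounded_measurable_integrable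
        (bounded_measurable_sqr bf)).
    by apply: eq_integral => s _; rewrite gee0_abs// lee_fin sqr_ge0.
  by rewrite f0.
have mf : measurable_fun `[0, t]%classic (fun s => (f s ^+ 2)%:E).
  by apply/measurable_EFinP; case: (bounded_measurable_sqr bf).
have [+ _] := ae_eq_integral_abs mu (measurable_itv `[0, t]) mf.
move=> /[apply] -[N [mN N0 fN]].
apply: contrapT => nex.
have abN : `]a, b[%classic `<=` N.
  move=> s /=; rewrite in_itv/= => sab; apply: fN => /= fs; apply: nex.
  exists s => //; apply/eqP; rewrite -sqrf_eq0; apply/eqP.
  have [//] : (f s ^+ 2)%:E = 0%:E; apply: fs; rewrite in_itv/=.
  by case/andP: sab => *; apply/andP; split; lra.
have : (mu `]a, b[%classic <= mu N)%E by apply: le_measure; rewrite ?inE.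
rewrite N0 lebesgue_measure_itv/= lte_fin ab -EFinB lee_fin.
by rewrite leNgt subr_gt0 ab.
Qed.

(** Points [u] with [V u = p.[u]] are dense. Those just right of [s] bound [V s] above and those
    just left bound it below, by continuity of [p]. At 0 there is no left side, and right-continuity
    of [V] takes its place. *)
Lemma nondecreasing_sqnorm0_poly V p t : {homo V : r s / r <= s} ->
  (forall e, 0 < e -> exists2 r, 0 < r & V r <= V 0 + e) ->
  sqnorm t (fun s => V s - p.[s]) = 0 ->
  forall s, 0 <= s < t -> V s = p.[s].
Proof.
move=> ndV rcV Vp s /andP[s0 st].
have bVp : bounded_measurable t (fun s => V s - p.[s]).
  by apply: bounded_measurableB;
    [exact: bounded_measurable_nondecreasing | exact:
      bounded_measurable_horner].
have dense a b (a0 : 0 <= a) (ab : a < b) (bt : b <= t) :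
    exists2 u, a < u < b & V u = p.[u].
  have [u uab /eqP] := sqnorm0_dense bVp Vp a0 ab bt.
  by rewrite subr_eq0 => /eqP; exists u.
have near_p e : 0 < e -> exists2 r, 0 < r &
    forall u, `|s - u| < r -> `|p.[s] - p.[u]| < e.
  move=> e0; have /cvgrPdist_lt/(_ _ e0)/nbhs_ballP[r /= r0 rp] :=
    @continuous_horner _ p s.
  by exists r => // u; exact: rp.
apply/eqP; rewrite eq_le; apply/andP; split; rewrite leNgt; apply/negP => ltVp.
  have [|r r0 pr] := near_p (V s - p.[s]); first by rewrite subr_gt0.
  have [||u /andP[su ur] Vu] := dense s (Num.min t (s + r)) s0.
  - by rewrite lt_min st ltrDl.
  - by rewrite ge_min lexx.
  move: ur; rewrite lt_min => /andP[_ ur].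
  have := pr u; rewrite !ltr_norml => /(_ _)/andP[]; first by apply/andP;
    split; lra.
  by have := ndV _ _ (ltW su); lra.
(* Half the gap, because at 0 it is spent twice: on the variation of [p] and on that of [V]. *)
pose e := (p.[s] - V s) / 2.
have e0 : 0 < e by rewrite divr_gt0// subr_gt0.
have [r r0 pr] := near_p e e0.
have close u : s - r < u -> u < s + r -> p.[s] - e < p.[u].
  by move=> h1 h2; have := pr u; rewrite !ltr_norml => /(_ _)/andP[];
    [apply/andP; split|]; lra.
have [s_eq0|s_gt0] := eqVneq s 0.
  have [r' r'0 Vr'] := rcV e e0.
  have [||u /andP[su ur] Vu] := dense s (Num.min t (Num.min (s + r) r')) s0.
  - by rewrite !lt_min st ltrDl r0 s_eq0.
  - by rewrite ge_min lexx.
  move: ur; rewrite !lt_min => /and3P[_ ur ur'].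
  have := close u; rewrite -Vu => /(_ _ ur).
  have := ndV _ _ (ltW ur'); move: Vr'; rewrite -s_eq0 /e => *; lra.
have sp : 0 < s by rewrite lt_def s_gt0.
(* The maximum keeps the interval inside [[0, t]]. *)
have [|||u /andP[su ur] Vu] := dense (Num.max 0 (s - r)) s.
- by rewrite le_max lexx.
- by rewrite gt_max sp; lra.
- exact: ltW.
move: su; rewrite gt_max => /andP[_ su].
have := close u su; rewrite -Vu.
by have := ndV _ _ (ltW ur); rewrite /e; lra.
Qed.
End monotone_functions.

(** Testing against real thresholds on either side of the limit treats finite and infinite reach at
    once. *)
Lemma cvge_real_bounds (R : realType) (u : nat -> \bar R) (l : \bar R) :
  (forall r : R, (r%:E < l)%E -> \forall n \near \oo, (r%:E <= u n)%E) ->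
  (forall r : R, (l < r%:E)%E -> \forall n \near \oo, (u n <= r%:E)%E) ->
  u n @[n --> \oo] --> l.
Proof.
case: l => [l|lo _|_ hi]; last 2 first.
- by apply/cvgeyPge => r; apply: lo; exact: ltry.
- by apply/cvgeNyPle => r; apply: hi; exact: ltNyr.
move=> lo hi.
have near_l e : 0 < e ->
    \forall n \near \oo, ((l - e)%:E <= u n)%E && (u n <= (l + e)%:E)%E.
  move=> e0; near=> n; apply/andP; split; near: n.
    by apply: lo; rewrite lte_fin ltrBlDr ltrDl.
  by apply: hi; rewrite lte_fin ltrDl.
apply/fine_cvgP; split.
  apply: filterS (near_l 1 ltr01) => n.
  by case: (u n) => [x| |]//=; rewrite leye_eq andbF.
apply/cvgrPdist_le => e e0; apply: filterS (near_l e e0) => n /=.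
case: (u n) => [x| |] /=; rewrite ?leye_eq ?leeNy_eq ?andbF//= !lee_fin.
by move=> /andP[lx xl]; rewrite ler_norml; apply/andP; split; lra.
Unshelve. all: by end_near. Qed.

(** * Bounds on the estimator below and beyond the polynomial reach *)

Section reach.
Variables (R : realType) (d : nat).
Implicit Types (A S : set 'rV[R]_d) (t r g eps : R).

Lemma bounded_measurable_volume A t : bounded_set A -> bounded_measurable t
  (volume A).
Proof. by move=> bA; apply: bounded_measurable_nondecreasing;
  exact: volume_nondecreasing. Qed.

Lemma bounded_subset A S : A `<=` S -> bounded_set S -> bounded_set A.
Proof.
by move=> AS [M [Mr SM]]; exists M; split => // N /SM SN x /AS; exact: SN.
Qed.

Lemma sqnorm_volume_le A S t g : bounded_set S -> A `<=` S ->
  S `<=` parallel_set A g -> 0 <= g -> 0 <= t ->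
  sqnorm t (fun s => volume S s - volume A s) <= volume S t ^+ 2 * g.
Proof.
move=> bS AS SA g0 t0; have bA := bounded_subset AS bS.
apply: sqnorm_sandwich_le => //; try exact: volume_nondecreasing;
  try exact: volume_ge0.
- by move=> s; apply: le_volume => //; exact: parallel_setS.
- move=> s; apply: le_volume => //.
  (* Reads [s] as [(s - g) + g], which gives the lower half of the sandwich. *)
  by rewrite -[s in X in _ `<=` X](subrK g); exact: parallel_set_trans.
Qed.

(** For [t < r] the polynomial [p] competes with the best one, and its error is the L2 distance
    between the two volume functions, hence at most [eps]. So no such [t] enters the infimum. *)
Lemma le_reach_estimator A S r g eps (p : {poly R}) : bounded_set S ->
  A `<=` S -> S `<=` parallel_set A g -> 0 <= g -> 0 < eps ->
  volume S r ^+ 2 * g <= eps ^+ 2 ->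
  (size p <= d.+1)%N -> (forall s, 0 <= s <= r -> volume S s = p.[s]) ->
  (r%:E <= reach_estimator A eps)%E.
Proof.
move=> bS AS SA g0 eps0 Vg pd Vp; have bA := bounded_subset AS bS.
apply: le_ereal_inf_tmp => _ [t [t0 epst] <-]; rewrite lee_fin leNgt.
apply/negP => tr; move: epst; apply/negP; rewrite -leNgt.
have [_ /(_ p pd) best] := best_poly_spec d (bounded_measurable_volume t bA).
apply: le_trans best _.
rewrite -ler_sqr ?nnegrE ?(ltW eps0)// ?sqrtr_ge0// sqr_L2norm;
  apply: le_trans Vg.
have -> : sqnorm t (fun s => volume A s - p.[s]) =
    sqnorm t (fun s => volume S s - volume A s).
  apply: eq_Rintegral => s; rewrite inE/= in_itv/= => /andP[s0 st].
  by rewrite Vp ?s0 ?(le_trans st (ltW tr))//; ring.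
apply: le_trans (sqnorm_volume_le bS AS SA g0 (ltW t0)) _.
rewrite ler_wpM2r// ler_sqr ?nnegrE ?volume_ge0//.
by apply: volume_nondecreasing => //; exact: ltW.
Qed.

Lemma poly_reach_ge0 S : (0 <= poly_reach S)%E.
Proof.
apply: ereal_sup_ubound; exists 0 => //; split => //.
exists (volume S 0)%:P; split; first exact: leq_trans (size_polyC_leq1 _) _.
by move=> s /le_anti <-; rewrite hornerC.
Qed.

(** A zero misfit would make the volume function equal to [p] on [[0, r[], so the midpoint of the
    reach and [r] would be an admissible radius beyond the reach. *)
Lemma poly_misfit_gt0 S r (p : {poly R}) : compact S ->
  (poly_reach S < r%:E)%E -> (size p <= d.+1)%N ->
  0 < sqnorm r (fun s => volume S s - p.[s]).
Proof.
move=> cS Sr pd; have bS := compact_bounded cS.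
rewrite lt_def sqnorm_ge0 andbT; apply/eqP => Sp.
have Vp := nondecreasing_sqnorm0_poly (volume_nondecreasing bS)
  (volume_right_continuous0 cS) Sp.
move: Sr (poly_reach_ge0 S); case ES: (poly_reach S) => [x| |]//.
rewrite lte_fin lee_fin => xr x0.
have : (((x + r) / 2)%:E <= poly_reach S)%E.
  apply: ereal_sup_ubound; exists ((x + r) / 2) => //; split; first by lra.
  exists p; split => // s /andP[s0 sxr]; apply: Vp.
  by apply/andP; split; lra.
by rewrite ES lee_fin; lra.
Qed.

(** Otherwise the fit error at [r] is at most [eps], and the best polynomial for [A] lies too close
    to the volume function of [S]: by [sqnormD_le] its squared distance is below [c]. *)
Lemma reach_estimator_le A S r g eps c : bounded_set S ->
  A `<=` S -> S `<=` parallel_set A g -> 0 <= g -> 0 < r -> 0 <= eps ->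
  (forall q : {poly R}, (size q <= d.+1)%N ->
     c <= sqnorm r (fun s => volume S s - q.[s])) ->
  2 * (volume S r ^+ 2 * g) + 2 * eps ^+ 2 < c ->
  (reach_estimator A eps <= r%:E)%E.
Proof.
move=> bS AS SA g0 r0 eps0 cS Vc; have bA := bounded_subset AS bS.
have [fit_le|fit_gt] := leP (fit_error A r) eps; last first.
  by apply: ereal_inf_lbound; exists r.
have [qd _] := best_poly_spec d (bounded_measurable_volume r bA).
exfalso; move: Vc; apply/negP; rewrite -leNgt; apply: le_trans (cS _ qd) _.
set q := best_poly _ _ _.
have bVA : bounded_measurable r (fun s => volume S s - volume A s).
  by apply: bounded_measurableB; exact: bounded_measurable_volume.
have bAq : bounded_measurable r (fun s => volume A s - q.[s]).
  by apply: bounded_measurableB;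
    [exact: bounded_measurable_volume | exact: bounded_measurable_horner].
have -> : (fun s => volume S s - q.[s]) =
    (fun s => (volume S s - volume A s) + (volume A s - q.[s])).
  by apply/funext => s; rewrite addrA subrK.
apply: le_trans (sqnormD_le bVA bAq) _.
rewrite lerD ?ler_pM2l//; first exact: sqnorm_volume_le (ltW r0).
rewrite -sqr_L2norm ler_sqr ?nnegrE// sqrtr_ge0//.
Qed.
End reach.

(** * Convergence of the reach estimator *)

Lemma hausdorff_dist_ge0 (R : realType) (d : nat) (A B : set 'rV[R]_d) :
  B !=set0 -> (0 <= hausdorff_dist A B)%E.
Proof.
move=> [y By]; rewrite /hausdorff_dist le_max; apply/orP; right.
apply: (@le_trans _ _ (dist_to A y)); last first.
  by apply: ereal_sup_ubound; exists y.
by apply: le_ereal_inf_tmp => _ [x _ <-]; rewrite lee_fin enorm_ge0.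
Qed.

Theorem theorem1 (R : realType) (d : nat) (S : set 'rV[R]_d)
    (S_nonempty : S !=set0) (S_compact : compact S)
    (X : forall n, 'I_n -> 'rV[R]_d)
    (X_in_S : forall n i, S (X n i))
    (gamma_to0 : hausdorff_dist (range (X n)) S @[n --> \oo] --> (0 : \bar R))
    (eps : nat -> R) (eps_gt0 : forall n, 0 < eps n)
    (eps_to0 : eps n @[n --> \oo] --> (0 : R))
    (gamma_o_eps :
      (fun n => Num.sqrt (fine (hausdorff_dist (range (X n)) S))) =o_\oo eps) :
  reach_estimator (range (X n)) (eps n) @[n --> \oo] --> poly_reach S.
Proof.
have bS := compact_bounded S_compact.
have XS n : range (X n) `<=` S by move=> _ [i _ <-].
(* At [n = 0] the sample is empty, the distance is infinite and [fine] returns 0; the inclusion [SX]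
   is therefore only claimed eventually. *)
pose g n := fine (hausdorff_dist (range (X n)) S).
have g0 n : 0 <= g n by rewrite fine_ge0// hausdorff_dist_ge0.
have SX : \forall n \near \oo, S `<=` parallel_set (range (X n)) (g n).
  have /fine_cvgP[fin _] := gamma_to0; apply: filterS fin => n fin_n.
  by apply: (@hausdorff_sub_parallel _ _ (range (X n))); rewrite fineK.
have Vg r : \forall n \near \oo, volume S r ^+ 2 * g n <= eps n ^+ 2.
  (* The volume may vanish; adding 1 makes its inverse a valid constant for the little-o
     hypothesis. *)
  have V1 : 0 < volume S r + 1 by rewrite ltr_wpDl ?volume_ge0.
  have : \forall n \near \oo,
      `|Num.sqrt (g n)| <= (volume S r + 1)^-1 * `|eps n|.
    by move/eqoP : gamma_o_eps; apply; rewrite invr_gt0.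
  apply: filterS => n; rewrite ger0_norm ?sqrtr_ge0// gtr0_norm// => le_g.
  rewrite -[g n]sqr_sqrtr// -exprMn ler_sqr ?nnegrE ?mulr_ge0 ?volume_ge0
    ?sqrtr_ge0 ?(ltW (eps_gt0 n))//.
  apply: (@le_trans _ _ ((volume S r + 1) * Num.sqrt (g n))).
    by rewrite ler_wpM2r ?sqrtr_ge0// lerDl.
  by rewrite -ler_pdivlMl.
apply: cvge_real_bounds => r.
  move=> /ereal_sup_gt[_ [r' [r'0 [p [pd Vp]]] <-]]; rewrite lte_fin => rr'.
  near=> n; apply: (@le_trans _ _ r'%:E); first by rewrite lee_fin ltW.
  apply: (@le_reach_estimator _ _ _ S _ (g n) _ p) => //.
  - by near: n.
  - by near: n; exact: Vg.
move=> Sr; have r0 : 0 < r.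
  by rewrite -lte_fin (le_lt_trans (poly_reach_ge0 S)).
have [bd bmin] := best_poly_spec d (bounded_measurable_volume r bS).
set p := best_poly _ _ _ in bd bmin.
have c0 := poly_misfit_gt0 S_compact Sr bd.
set c := sqnorm _ _ in c0.
(* The best polynomial attains the minimum, so its positive misfit [c] bounds that of all
   competitors uniformly. *)
have cmin (q : {poly R}) : (size q <= d.+1)%N -> c <= sqnorm r (fun s => volume
  S s - q.[s]).
  by move=> /bmin; rewrite /c -!sqr_L2norm ler_sqr ?nnegrE ?sqrtr_ge0.
near=> n; apply: (@reach_estimator_le _ _ _ S _ (g n) _ c) => //.
- by near: n.
- exact: ltW.
have Vgn : volume S r ^+ 2 * g n <= eps n ^+ 2 by near: n; exact: Vg.
(* By [Vgn], each of the two terms to be bounded is at most [2 * eps n ^+ 2]. *)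
suff : 4 * eps n ^+ 2 < c by lra.
have eps2 : eps n ^+ 2 < c / 4; last by lra.
near: n.
have : (fun n => eps n ^+ 2) @ \oo --> (0 : R).
  by rewrite -[X in _ --> X](expr0n R 2); exact: cvgM.
by move=> /cvgr_lt; apply; lra.
Unshelve. all: by end_near. Qed.
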